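(* Let $n\ge 1$, let $\{P_\ell\}_{\ell=1}^{n!}$ be any enumeration of the set $\mathcal P_n$ of $n\times n$ permutation matrices, and for $A\in\mathcal D_n$ let $(\alpha_\ell,P_\ell)_{\ell=1}^{n!}$, $\alpha_\ell=\alpha_\ell(A)$, be the continuous Birkhoff decomposition of $A$ induced by this enumeration. Then: (i) each $\alpha_\ell$ is a Lipschitz continuous function from $\mathcal D_n$ to $\mathbb R$; (ii) for every $A\in\mathcal D_n$, all $\alpha_\ell(A)$ are non-negative and $\sum_{\ell=1}^{n!}\alpha_\ell(A)=1$; (iii) for every $A\in\mathcal D_n$, $A=\sum_{\ell=1}^{n!}\alpha_\ell(A)P_\ell$; (iv) for every $A\in\mathcal D_n$, at most $n^2-n+1$ of the coefficients $\alpha_\ell(A)$ are non-zero.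
   Context: $\mathcal D_n\subset\mathbb R^{n\times n}$ denotes the Birkhoff polytope, i.e. the set of $n\times n$ doubly stochastic matrices (non-negative entries, every row and every column sums to $1$), with the topology/metric inherited from Euclidean $\mathbb R^{n^2}$. $\mathcal P_n\subset\mathcal D_n$ is the set of $n\times n$ permutation matrices. Continuous Birkhoff decomposition: given an enumeration $\{P_\ell\}_{\ell=1}^{n!}$ of $\mathcal P_n$ (a fixed total order on all permutation matrices) and $A\in\mathcal D_n$, the continuous Birkhoff decomposition of $A$ induced by the enumeration is $(\alpha_\ell,P_\ell)_{\ell=1}^{n!}$, where the coefficients are defined recursively for $\ell=1,\dots,n!$ by $$\alpha_\ell=\min_{i,j}\Big\{A(i,j)-\sum_{m=1}^{\ell-1}\alpha_mP_m(i,j)\ \Big|\ P_\ell(i,j)=1\Big\}.$$ *)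

(* Defs.v *)
From HB Require Import structures.
From mathcomp Require Import all_boot all_order all_algebra.
From mathcomp Require Import reals.

Set Implicit Arguments.
Unset Strict Implicit.
Unset Printing Implicit Defensive.

Import Order.TTheory GRing.Theory Num.Theory.

Local Open Scope ring_scope.

Definition doubly_stochastic (R : realType) (n : nat) (A : 'M[R]_n) : Prop :=
  [/\ forall i j, 0 <= A i j,
      forall i, \sum_j A i j = 1
    & forall j, \sum_i A i j = 1].

(* The norm of R^(n^2); the norm that MathComp-Analysis puts on 'M[R]_n is the
   maximum norm instead. *)
Definition euclidean_norm (R : realType) (n : nat) (A : 'M[R]_n) : R :=
  Num.sqrt (\sum_i \sum_j A i j ^+ 2).

Definition lipschitz_on_birkhoff (R : realType) (n : nat)
    (f : 'M[R]_n -> R) : Prop :=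
  exists2 K : R, 0 <= K &
    forall A B : 'M[R]_n, doubly_stochastic A -> doubly_stochastic B ->
      `|f A - f B| <= K * euclidean_norm (A - B).

Definition enumerates_perm_mx (R : realType) (n : nat)
    (P : 'I_(n`!) -> 'M[R]_n) : Prop :=
  injective P /\ (forall M : 'M[R]_n, is_perm_mx M <-> exists l, P l = M).

(* Junk value 0 on the empty sequence. *)
Definition seq_min (R : realType) (s : seq R) : R :=
  \big[Num.min/head 0 s]_(x <- s) x.

Lemma seq_min_le (R : realType) (s : seq R) (x : R) :
  x \in s -> seq_min s <= x.
Proof.
rewrite /seq_min; move: (head 0 s) => y; elim: s => //= z s IHs.
rewrite inE big_cons ge_min => /predU1P[-> | /IHs ->]; first by rewrite lexx.
by rewrite orbT.
Qed.

Lemma seq_min_in (R : realType) (s : seq R) : s != [::] -> seq_min s \in s.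
Proof.
case: s => // y s _; rewrite /seq_min big_seq /=.
apply: (big_ind (fun x => x \in y :: s)); first exact: mem_head.
  by move=> u v us vs; rewrite minEle; case: ifP.
by [].
Qed.

Definition min_over_support (R : realType) (n : nat) (Q B : 'M[R]_n) : R :=
  seq_min [seq B ij.1 ij.2 | ij <- enum {: 'I_n * 'I_n} & Q ij.1 ij.2 == 1].

(* [k] is recursion fuel; [birkhoff_coefE] below is the defining recursion. *)
Fixpoint birkhoff_coef_rec (R : realType) (n : nat)
    (P : 'I_(n`!) -> 'M[R]_n) (A : 'M[R]_n) (k : nat) (l : 'I_(n`!)) : R :=
  if k is k'.+1 then
    min_over_support (P l)
      (A - \sum_(m < n`! | (m < l)%N) birkhoff_coef_rec P A k' m *: P m)
  else 0.

Definition birkhoff_coef (R : realType) (n : nat)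
    (P : 'I_(n`!) -> 'M[R]_n) (l : 'I_(n`!)) (A : 'M[R]_n) : R :=
  birkhoff_coef_rec P A l.+1 l.

Lemma birkhoff_coef_recE (R : realType) (n : nat)
    (P : 'I_(n`!) -> 'M[R]_n) (A : 'M[R]_n) (k : nat) (l : 'I_(n`!)) :
  (l < k)%N -> birkhoff_coef_rec P A k l = birkhoff_coef P l A.
Proof.
have fuel_irr : forall k1 k2 (i : 'I_(n`!)), (i < k1)%N -> (i < k2)%N ->
    birkhoff_coef_rec P A k1 i = birkhoff_coef_rec P A k2 i.
  elim=> [|k1 IHk] [|k2] i //= ik1 ik2.
  congr (min_over_support _ (_ - _)); apply: eq_bigr => m mi.
  by rewrite (IHk k2) // (leq_trans mi).
by move=> lk; apply: fuel_irr.
Qed.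

Lemma birkhoff_coefE (R : realType) (n : nat)
    (P : 'I_(n`!) -> 'M[R]_n) (l : 'I_(n`!)) (A : 'M[R]_n) :
  birkhoff_coef P l A =
  min_over_support (P l)
    (A - \sum_(m < n`! | (m < l)%N) birkhoff_coef P m A *: P m).
Proof.
rewrite {1}/birkhoff_coef /=; congr (min_over_support _ (_ - _)).
by apply: eq_bigr => m ml; rewrite birkhoff_coef_recE.
Qed.

(* Main.v *)
Require Import Defs.
From HB Require Import structures.
From mathcomp Require Import all_boot all_order all_algebra.
From mathcomp Require Import fingroup perm.
From mathcomp Require Import reals.
From mathcomp Require Import zify ring.

Set Implicit Arguments.
Unset Strict Implicit.
Unset Printing Implicit Defensive.

Import Order.TTheory GRing.Theory Num.Theory.

Local Open Scope ring_scope.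

(* Let A_l = A - \sum_(m < l) alpha_m P_m.  As alpha_l is the least entry of A_l
   on the support of P_l, subtracting alpha_l P_l keeps A_l nonnegative with
   constant line sums, and creates a zero on the support of P_l which survives.
   So the last residual has a zero on the support of every permutation matrix;
   by Hall's theorem this is impossible for a nonnegative matrix with constant
   positive line sums, so the last residual vanishes.  Each nonzero coefficient
   annihilates an entry, while at least n entries are still nonzero just before
   the last nonzero coefficient is subtracted: hence n^2 - n + 1.  Finally, a
   minimum of entries is 1-Lipschitz, so the Lipschitz constant of A |-> A_l
   at most doubles at each step. *)

(** * Hall's theorem and permutations inside the support of a nonnegative matrix *)

(** Induction on the size of [A], split on whether some nonempty proper subset is critical, that is,
    has exactly as many neighbours as elements. The matching takes values in [option T] because [T]
    may be empty and nothing is required outside [A]. *)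
Lemma hall_matching (S T : finType) (e : S -> T -> bool) (A : {set S}) :
  (forall X : {set S}, X \subset A ->
     (#|X| <= #|[set y | [exists x in X, e x y]]|)%N) ->
  exists f : S -> option T,
    {in A &, injective f} /\
    (forall x, x \in A -> exists2 y, f x = Some y & e x y).
Proof.
have [k] := ubnP #|A|; elim: k => // k IHk in e A *; rewrite ltnS => Ak hall.
have [-> | [x0 x0A]] := set_0Vmem A.
  by exists (fun=> None); split=> [x y|x]; rewrite inE.
case: (boolP [exists X : {set S}, [&& X \proper A, X != set0 &
    #|[set y | [exists x in X, e x y]]| == #|X| ]]) => [/existsP[X]|].
- case/and3P=> XA X0 /eqP critX; set NX := [set y | _] in critX.
  have sXA := proper_sub XA.
  case: (IHk e X) => [|Y YX|f [f_inj f_e]].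
  + exact: leq_trans (proper_card XA) Ak.
  + exact: hall (subset_trans YX sXA).
  (* The rest of [A] is matched outside [NX], so that the two matchings cannot collide. *)
  case: (IHk (fun x y => e x y && (y \notin NX)) (A :\: X)) => [|Y YAX|g [g_inj g_e]].
  + rewrite (leq_trans _ Ak) // cardsD (setIidPr sXA).
    by have := subset_leq_card sXA; move: X0; rewrite -card_gt0; lia.
  + have YX : [disjoint Y & X].
      by rewrite disjoints_subset (subset_trans YAX) // setDE subsetIr.
    have := hall (Y :|: X); rewrite subUset sXA (subset_trans YAX (subsetDl _ _)).
    move=> /(_ isT); rewrite cardsU disjoint_setI0 // cards0 subn0 => le1.
    rewrite -(leq_add2r #|X|) (leq_trans le1) // -critX.
    (* The neighbours of [Y :|: X] lie in [NX] or are neighbours of [Y] outside [NX]. Since [NX] has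
       exactly [#|X|] elements, cancelling leaves Hall's condition for [Y]. *)
    apply: leq_trans (_ : #|[set y | [exists x in Y, e x y && (y \notin NX)]] :|: NX| <= _)%N.
      apply/subset_leq_card/subsetP=> y; rewrite in_setU in_set => /existsP[x /andP[]].
      case: (boolP (y \in NX)) => [_|yNX]; first by rewrite orbT.
      rewrite in_setU => /orP[xY|xX] exy; rewrite inE.
        by apply/orP; left; apply/existsP; exists x; rewrite xY exy.
      by case/negP: yNX; rewrite inE; apply/existsP; exists x; rewrite xX.
    by rewrite cardsU leq_subr.
  have fNX x : x \in X -> exists2 y, f x = Some y & y \in NX.
    by move=> xX; have [y fy exy] := f_e _ xX; exists y => //;
       rewrite inE; apply/existsP; exists x; rewrite xX.
  exists (fun x => if x \in X then f x else g x); split=> [x y xA yA|x xA].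
  + case: ifP => xX; case: ifP => yX.
    * exact: f_inj.
    * have [z -> zN] := fNX _ xX; have [|w -> /andP[_ wN]] := g_e y.
        by rewrite inE yX.
      by move=> [zw]; rewrite -zw zN in wN.
    * have [z -> zN] := fNX _ yX; have [|w -> /andP[_ wN]] := g_e x.
        by rewrite inE xX.
      by move=> [zw]; rewrite zw zN in wN.
    * by apply: g_inj; rewrite inE ?xX ?yX.
  + case: ifP => xX; first exact: f_e.
    by have [|y gy /andP[]] := g_e x; [rewrite inE xX | exists y].
(* Without a critical set, [x0] may be matched with any neighbour [y0]: deleting [y0] costs at most
   one neighbour, which the now strict inequality affords. *)
- rewrite negb_exists => /forallP noncrit.
  have := hall [set x0]; rewrite sub1set cards1 => /(_ x0A).
  case/card_gt0P=> y0; rewrite inE => /existsP[x /andP[/set1P-> exy0]].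
  case: (IHk (fun x y => e x y && (y != y0)) (A :\ x0)) => [|Y YA|f [f_inj f_e]].
  + by move: Ak; rewrite (cardsD1 x0 A) x0A.
  + have [->|Y0] := eqVneq Y set0; first by rewrite cards0.
    have YpA : Y \proper A.
      apply/properP; split; first exact: subset_trans YA (subsetDl _ _).
      by exists x0 => //; apply/negP=> /(subsetP YA); rewrite !inE eqxx.
    have := noncrit Y; rewrite YpA Y0 /= => ncY.
    have := hall _ (proper_sub YpA); rewrite leq_eqVlt eq_sym (negPf ncY) /= => ltY.
    rewrite -ltnS (leq_trans ltY) // (cardsD1 y0) -add1n leq_add ?leq_b1 //.
    apply/subset_leq_card/subsetP=> y; rewrite !inE => /andP[yy0 /existsP[z /andP[zY ezy]]].
    by apply/existsP; exists z; rewrite zY ezy.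
  exists (fun x => if x == x0 then Some y0 else f x).
  have f_y0 z : z \in A -> z != x0 -> f z <> Some y0.
    move=> zA zx; have [|w -> /andP[_ wy0]] := f_e z; first by rewrite !inE zx.
    by move=> [wE]; rewrite wE eqxx in wy0.
  split=> [u v uA vA|u uA].
  + case: eqVneq => [->|ux]; case: eqVneq => [->|vx] //.
    * by move=> E; case: (f_y0 v).
    * by move=> E; case: (f_y0 u).
    * by apply: f_inj; rewrite !inE ?ux ?vx.
  + case: eqVneq => [->|ux]; first by exists y0.
    by have [|w fw /andP[]] := f_e u; [rewrite !inE ux | exists w].
Qed.

(** Hall's condition follows by weighing: the rows in [X] have total mass [c *+ #|X|], all of it in
    the columns of [N], whose total mass is [c *+ #|N|]. *)
Lemma perm_in_support (R : realDomainType) (n : nat) (F : 'M[R]_n) (c : R) :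
  0 < c -> (forall i j, 0 <= F i j) ->
  (forall i, \sum_j F i j = c) -> (forall j, \sum_i F i j = c) ->
  exists s : {perm 'I_n}, forall i, F i (s i) != 0.
Proof.
move=> c0 F0 Fr Fc.
case: (@hall_matching _ _ (fun i j => F i j != 0) [set: 'I_n]) => [X _|f [f_inj f_e]].
  set N := [set j | _].
  have : c *+ #|X| <= c *+ #|N|.
    rewrite -!sumr_const -(eq_bigr _ (fun i _ => Fr i)) -(eq_bigr _ (fun j _ => Fc j)).
    rewrite [leRHS]exchange_big /= [leRHS](bigID (mem X)) /=.
    rewrite -[leLHS]addr0 lerD //; last first.
      by apply: sumr_ge0 => i _; apply: sumr_ge0.
    apply: ler_sum => i iX; rewrite (bigID (mem N)) /= [X in _ + X]big1 ?addr0 //.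
    move=> j jN; apply/eqP/negP=> Fij; case/negP: jN; rewrite inE.
    by apply/existsP; exists i; rewrite iX; apply/negP.
  by rewrite ler_pMn2l.
(* The default [i] is never reached, as [f] is defined on all of [[set: 'I_n]]. *)
pose g i := odflt i (f i).
have g_e i : f i = Some (g i) /\ F i (g i) != 0.
  by rewrite /g; have [|j ->] := f_e i; rewrite ?inE.
have g_inj : injective g.
  move=> i j gij; apply: f_inj; rewrite ?inE //.
  by rewrite (g_e i).1 (g_e j).1 gij.
by exists (perm g_inj) => i; rewrite permE (g_e i).2.
Qed.

(** * Minima over the support of a permutation matrix *)

Lemma perm_mx_entry (R : pzSemiRingType) (n : nat) (s : {perm 'I_n}) i j :
  (perm_mx s : 'M[R]_n) i j = (s i == j)%:R.
Proof. by rewrite !mxE. Qed.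

Lemma min_over_support_le (R : realType) (n : nat) (s : {perm 'I_n})
    (B : 'M[R]_n) (i : 'I_n) :
  min_over_support (perm_mx s) B <= B i (s i).
Proof.
apply: seq_min_le; apply/mapP; exists (i, s i) => //.
by rewrite mem_filter mem_enum /= !mxE !eqxx.
Qed.

(** For [0 < n] the support is nonempty, so the junk value of [seq_min] does not occur. *)
Lemma min_over_support_attained (R : realType) (n : nat) (s : {perm 'I_n})
    (B : 'M[R]_n) :
  (0 < n)%N -> exists i, min_over_support (perm_mx s) B = B i (s i).
Proof.
move=> n0; rewrite /min_over_support; set t := map _ _.
have /mapP[[i j]] : seq_min t \in t.
  apply: seq_min_in; rewrite -size_eq0 size_map size_filter -lt0n -has_count.
  apply/hasP; exists (Ordinal n0, s (Ordinal n0)); first by rewrite mem_enum.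
  by rewrite /= !mxE !eqxx.
rewrite mem_filter /= !mxE => /andP[+ _ ->].
by case: (s i =P j) => [<- _ | _]; [exists i | rewrite eq_sym oner_eq0].
Qed.

Lemma min_over_support_dist (R : realType) (n : nat) (s : {perm 'I_n})
    (B C : 'M[R]_n) (d : R) :
  (0 < n)%N -> (forall i j, `|B i j - C i j| <= d) ->
  `|min_over_support (perm_mx s) B - min_over_support (perm_mx s) C| <= d.
Proof.
move=> n0 BC.
(* Both matrices are compared at a minimiser for [V]; exchanging them gives the other inequality. *)
have half (U V : 'M[R]_n) : (forall i j, `|U i j - V i j| <= d) ->
    min_over_support (perm_mx s) U - min_over_support (perm_mx s) V <= d.
  move=> UV; have [i ->] := min_over_support_attained s V n0.
  apply: le_trans (UV i (s i)); apply: le_trans (ler_norm _).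
  by rewrite lerD2r min_over_support_le.
rewrite ler_norml half // andbT lerNl opprB half // => i j.
by rewrite distrC.
Qed.

Lemma entry_le_euclidean_norm (R : realType) (n : nat) (A : 'M[R]_n) i j :
  `|A i j| <= euclidean_norm A.
Proof.
rewrite -sqrtr_sqr /euclidean_norm ler_wsqrtr //.
rewrite (bigD1 i) //= (bigD1 j) //= -addrA lerDl addr_ge0 //.
  by apply: sumr_ge0 => k _; rewrite sqr_ge0.
by do 2!apply: sumr_ge0 => ? _; rewrite sqr_ge0.
Qed.

(** * Residuals of the decomposition: stability, sign, monotonicity and vanishing *)

(** The index [k] is a natural number, so that the last residual, at [k = n!], is included. *)
Definition residual (R : realType) (n : nat) (P : 'I_(n`!) -> 'M[R]_n)
    (A : 'M[R]_n) (k : nat) : 'M[R]_n :=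
  A - \sum_(m < n`! | (m < k)%N) birkhoff_coef P m A *: P m.

Section Residual.

Variables (R : realType) (n : nat) (P : 'I_(n`!) -> 'M[R]_n).
Hypotheses (n_gt0 : (0 < n)%N) (P_perm : forall l, is_perm_mx (P l)).

Let alpha A l := birkhoff_coef P l A.
Let res := residual P.

Lemma residual0 A : res A 0 = A.
Proof. by rewrite /res /residual big_pred0 ?subr0. Qed.

Lemma residual_full A : res A n`! = A - \sum_l alpha A l *: P l.
Proof. by rewrite /res /residual; congr (_ - _); apply: eq_bigl => m; rewrite ltn_ord. Qed.

Lemma birkhoff_coef_residual A l :
  birkhoff_coef P l A = min_over_support (P l) (res A l).
Proof. exact: birkhoff_coefE. Qed.

Lemma residualS A (l : 'I_(n`!)) i j :
  res A l.+1 i j = res A l i j - alpha A l * P l i j.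
Proof.
have -> : res A l.+1 = res A l - alpha A l *: P l.
  rewrite /res /residual (bigD1 l) //= opprD addrCA addrC; congr (_ - _ - _).
  by apply: eq_bigl => m; rewrite ltnS [RHS]ltn_neqAle andbC.
by move: (res A l) => B; rewrite !mxE.
Qed.

(** Both the old residual and the new coefficient move by at most the previous bound, and entries of
    [P l] are 0 or 1; hence a factor 2 per step. *)
Lemma residual_dist (A B : 'M[R]_n) (d : R) :
  (forall i j, `|A i j - B i j| <= d) ->
  forall k, (k <= n`!)%N ->
    forall i j, `|res A k i j - res B k i j| <= 2 ^+ k * d.
Proof.
move=> AB; elim=> [|k IHk] kn i j; first by rewrite !residual0 mul1r.
pose l := Ordinal kn; have {}IHk := IHk (ltnW kn).
have [s Ps] := is_perm_mxP _ (P_perm l).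
have := min_over_support_dist s n_gt0 IHk.
rewrite -Ps -[k]/(val l) -!birkhoff_coef_residual => dl.
rewrite (residualS A l) (residualS B l).
have -> (x y a c p : R) : x - a * p - (y - c * p) = x - y - (a - c) * p by ring.
apply: le_trans (ler_normB _ _) _; rewrite exprS -mulrA mulr_natl mulr2n lerD ?IHk //.
rewrite normrM; apply: le_trans dl; rewrite ler_piMr //.
by rewrite Ps perm_mx_entry normr_nat lern1 leq_b1.
Qed.

(** Only the residual at [l] is assumed nonnegative, so that this can serve inside the induction for
    [residual_ge0]. *)
Lemma residual_ge0_coef_ge0 A (l : 'I_(n`!)) :
  (forall i j, 0 <= res A l i j) -> 0 <= alpha A l.
Proof.
move=> res0; rewrite /alpha birkhoff_coef_residual.
have /is_perm_mxP[s ->] := P_perm l.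
by have [i ->] := min_over_support_attained s (res A l) n_gt0.
Qed.

Lemma residual_ge0 (A : 'M[R]_n) k :
  (forall i j, 0 <= A i j) -> (k <= n`!)%N -> forall i j, 0 <= res A k i j.
Proof.
move=> A0; elim: k => [|k IHk] kn i j; first by rewrite residual0.
have {}IHk := IHk (ltnW kn); pose l := Ordinal kn.
have := residual_ge0_coef_ge0 (l := l) IHk.
rewrite (residualS A l) /alpha birkhoff_coef_residual.
have /is_perm_mxP[s ->] := P_perm l.
rewrite perm_mx_entry subr_ge0; case: eqP => [<- _|_ _]; last by rewrite mulr0 IHk.
by rewrite mulr1 min_over_support_le.
Qed.

Lemma birkhoff_coef_ge0 (A : 'M[R]_n) l :
  (forall i j, 0 <= A i j) -> 0 <= birkhoff_coef P l A.
Proof. by move=> A0; apply: residual_ge0_coef_ge0; apply: residual_ge0 => //; exact: ltnW. Qed.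

(** Together with [residual_ge0], this makes every zero entry of a residual permanent. *)
Lemma residual_decr (A : 'M[R]_n) k m i j :
  (forall i j, 0 <= A i j) -> (k <= m)%N -> (m <= n`!)%N ->
  res A m i j <= res A k i j.
Proof.
move=> A0 km; rewrite -(subnKC km); elim: (m - k)%N => [|d IHd]; first by rewrite addn0.
rewrite addnS => dn; apply: le_trans (IHd (ltnW dn)).
rewrite (residualS A (Ordinal dn)) gerBl mulr_ge0 ?birkhoff_coef_ge0 //.
by have /is_perm_mxP[s ->] := P_perm (Ordinal dn); rewrite perm_mx_entry ler0n.
Qed.

Lemma residual_line_sums A : doubly_stochastic A ->
  let c := 1 - \sum_l alpha A l in
  (forall i, \sum_j res A n`! i j = c) /\ (forall j, \sum_i res A n`! i j = c).
Proof.
case=> _ Ar Ac c; rewrite residual_full; split=> [i|j].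
  under eq_bigr do rewrite !mxE summxE.
  rewrite sumrB Ar exchange_big /=; congr (_ - _); apply: eq_bigr => l _.
  have /is_perm_mxP[s ->] := P_perm l.
  under eq_bigr do rewrite !mxE.
  by rewrite -mulr_sumr (bigD1 (s i)) //= eqxx big1 ?addr0 ?mulr1 // => j /negPf;
     rewrite eq_sym => ->.
under eq_bigr do rewrite !mxE summxE.
rewrite sumrB Ac exchange_big /=; congr (_ - _); apply: eq_bigr => l _.
have /is_perm_mxP[s ->] := P_perm l.
under eq_bigr do rewrite !mxE.
(* The only 1 in column [j] of [perm_mx s] is in row [s^-1 j]. *)
rewrite -mulr_sumr (bigD1 (s^-1%g j)) //= permKV eqxx big1 ?addr0 ?mulr1 // => i.
by rewrite -(inj_eq (@perm_inj _ s)) permKV => /negPf ->.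
Qed.

Lemma residual_vanishes A : (forall s, exists l, P l = perm_mx s) ->
  doubly_stochastic A -> \sum_l alpha A l = 1 /\ res A n`! = 0.
Proof.
move=> P_all dsA; have [A0 _ _] := dsA; have [rr rc] := residual_line_sums dsA.
have res0 := residual_ge0 A0 (leqnn _).
have c0 : 1 - \sum_l alpha A l = 0.
  apply/eqP; rewrite eq_le; apply/andP; split; last first.
    by rewrite -(rr (Ordinal n_gt0)) sumr_ge0.
  (* If [c] were positive, some permutation [s] would lie in the support of the last residual. But
     [perm_mx s] is some [P l], and step [l] made an entry on its support vanish for good. *)
  rewrite leNgt; apply/negP => c_gt0.
  have [s /= res_s] := perm_in_support c_gt0 res0 rr rc.
  have [l Pl] := P_all s.
  have [i mi] := min_over_support_attained s (res A l) n_gt0.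
  have := residual_decr i (s i) A0 (ltn_ord l) (leqnn _).
  rewrite residualS /alpha birkhoff_coef_residual Pl mi perm_mx_entry eqxx mulr1 subrr => le0.
  by case/negP: (res_s i); rewrite eq_le le0 res0.
split; first by apply/esym/eqP; rewrite -subr_eq0 c0.
apply/matrixP=> i j; rewrite [RHS]mxE.
by apply: (psumr_eq0P (P := xpredT) (F := res A n`! i)) => //; rewrite rr.
Qed.

(** * Counting the nonzero coefficients *)

(** The left-hand side never increases with [k]: a nonzero coefficient adds one to the first count
    and removes at least one entry from the second. *)
Lemma card_coef_residual_neq0 (A : 'M[R]_n) k : (forall i j, 0 <= A i j) -> (k <= n`!)%N ->
  (#|[set l : 'I_(n`!) | (l < k)%N && (alpha A l != 0)%R]|
     + #|[set ij | res A k ij.1 ij.2 != 0%R]| <= n * n)%N.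
Proof.
move=> A0; elim: k => [|k IHk] kn.
  rewrite [X in (X + _)%N]eq_card0 => [|l]; last by rewrite !inE.
  by rewrite add0n (leq_trans (max_card _)) // card_prod card_ord.
have {}IHk := IHk (ltnW kn); pose l := Ordinal kn.
have res_sub : [set ij | res A k.+1 ij.1 ij.2 != 0] \subset [set ij | res A k ij.1 ij.2 != 0].
  apply/subsetP=> -[i j]; rewrite !inE /=; apply: contraNneq => resk.
  by rewrite eq_le residual_ge0 // andbT -resk residual_decr.
have [al0|al0] := eqVneq (alpha A l) 0.
  apply: leq_trans IHk; rewrite leq_add ?subset_leq_card //.
  apply/subsetP=> m; rewrite !inE ltnS leq_eqVlt => /andP[/predU1P[mk|->]] //.
  by rewrite (_ : m = l) ?al0 ?eqxx //; apply: val_inj.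
apply: leq_trans IHk; rewrite (cardsD1 l) inE ltnSn al0 /= add1n addSnnS leq_add //.
  apply/subset_leq_card/subsetP=> m; rewrite !inE => /andP[ml /andP[mk ->]].
  by rewrite andbT ltn_neqAle -ltnS mk andbT.
(* The entry lost is one where the minimum defining [alpha A l] is attained: its value drops from
   [alpha A l], which is nonzero, to 0. *)
apply/proper_card/properP; split=> //.
have [s Ps] := is_perm_mxP _ (P_perm l).
have [i mi] := min_over_support_attained s (res A l) n_gt0.
have alE : alpha A l = res A k i (s i) by rewrite /alpha birkhoff_coef_residual Ps mi.
exists (i, s i); first by rewrite inE /= -alE.
by rewrite inE /= (residualS A l) alE Ps perm_mx_entry eqxx mulr1 subrr eqxx.
Qed.

(** The [n] entries on the support of [P l] are all at least [alpha A l], which is positive. *)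
Lemma card_residual_ge (A : 'M[R]_n) (l : 'I_(n`!)) : (forall i j, 0 <= A i j) ->
  alpha A l != 0 -> (n <= #|[set ij | res A l ij.1 ij.2 != 0%R]|)%N.
Proof.
move=> A0 al0; have [s Ps] := is_perm_mxP _ (P_perm l).
have inj_s : injective (fun i => (i, s i)) by move=> i j [].
rewrite -[leqLHS]card_ord -(card_codom inj_s).
apply/subset_leq_card/subsetP=> _ /codomP[i ->]; rewrite inE /=.
apply: lt0r_neq0; apply: lt_le_trans (min_over_support_le s (res A l) i).
by rewrite -Ps -birkhoff_coef_residual lt0r al0 birkhoff_coef_ge0.
Qed.

Lemma card_coef_neq0 (A : 'M[R]_n) : (forall i j, 0 <= A i j) ->
  (#|[set l | birkhoff_coef P l A != 0%R]| <= n ^ 2 - n + 1)%N.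
Proof.
move=> A0; set S := [set l | _].
have [->|[l0 l0S]] := set_0Vmem S; first by rewrite cards0.
(* With [l] the last index of a nonzero coefficient, the count just before step [l] gives
   [#|S :\ l| + n <= n * n]; the index [l] itself supplies the final [+ 1]. *)
case: (arg_maxnP (fun l : 'I_(n`!) => val l) l0S) => l lS l_max.
have {}lS : l \in S := lS.
have al0 : alpha A l != 0 by rewrite inE in lS.
have := card_coef_residual_neq0 A0 (ltnW (ltn_ord l)).
have := card_residual_ge A0 al0.
rewrite (cardsD1 l S) lS.
have -> : S :\ l = [set m : 'I_(n`!) | (m < l)%N && (alpha A m != 0)].
  apply/setP=> m; rewrite !inE ltn_neqAle -andbA.
  case: (boolP (birkhoff_coef P m A != 0)) => al; rewrite ?andbF // !andbT.
  have mS : m \in S by rewrite inE.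
  by rewrite [(m <= l)%N](l_max _ mS) andbT.
by rewrite -mulnn; lia.
Qed.

End Residual.

Theorem theorem2p4 (R : realType) (n : nat) (n_ge1 : (1 <= n)%N)
    (P : 'I_(n`!) -> 'M[R]_n) (P_enum : enumerates_perm_mx P) :
  [/\ forall l, lipschitz_on_birkhoff (birkhoff_coef P l),
      forall A : 'M[R]_n, doubly_stochastic A ->
        (forall l, 0 <= birkhoff_coef P l A) /\
        \sum_(l < n`!) birkhoff_coef P l A = 1,
      forall A : 'M[R]_n, doubly_stochastic A ->
        A = \sum_(l < n`!) birkhoff_coef P l A *: P l
    & forall A : 'M[R]_n, doubly_stochastic A ->
        (#|[set l | birkhoff_coef P l A != 0%R]| <= n ^ 2 - n + 1)%N].
Proof.
have [_ P_mem] := P_enum.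
have P_perm l : is_perm_mx (P l) by apply/P_mem; exists l.
have P_all s : exists l, P l = perm_mx s by apply/P_mem/perm_mx_is_perm.
split=> [l|A dsA|A dsA|A [A0 _ _]].
(* The residuals before step [l] differ entrywise by at most [2 ^+ l] times the norm of [A - B], and
   taking the minimum adds no further factor. *)
- exists (2 ^+ l); first exact: exprn_ge0.
  move=> A B _ _; rewrite !birkhoff_coef_residual.
  have [s Ps] := is_perm_mxP _ (P_perm l); rewrite Ps.
  apply: min_over_support_dist => // i j.
  apply: residual_dist => // [{}i {}j|]; last exact: ltnW.
  by have := entry_le_euclidean_norm (A - B) i j; rewrite !mxE.
- split=> [l|]; first by apply: birkhoff_coef_ge0 => //; case: dsA.
  by have [] := residual_vanishes n_ge1 P_perm P_all dsA.
- have [_ /eqP] := residual_vanishes n_ge1 P_perm P_all dsA.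
  by rewrite residual_full subr_eq0 => /eqP.
- exact: card_coef_neq0.
Qed.
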